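(* For every integer $n\geq 1$, the HOMFLY polynomial of the torus link $T(3,n)$ is $$P(T(3,n);y,z)=(y^2+1)z^{-2}G_{n+3}+\bigl((1+y^{-2})z^{-2}-y^{-2}\bigr)G_{n+2}+\bigl(y^{-6}-(y^{-6}+y^{-8})z^{-2}\bigr)G_n-(y^{-8}+y^{-10})z^{-2}G_{n-1},$$ where the sequence $(G_n)_{n\ge 0}$ is defined by $$\frac{X^3}{1-(y^{-2}z^2-y^{-2})X+y^{-4}z^2X^2-(y^{-6}z^2-y^{-6})X^3+y^{-8}X^4}=\sum_{n=0}^\infty G_nX^n$$ in the formal power series ring $\mathbb{Q}(y,z)[[X]]$.
   Context: A crossing of an oriented link diagram in the oriented plane is positive if the ordered pair (tangent vector of the overpassing arc, tangent vector of the underpassing arc) agrees with the orientation of the plane, and negative otherwise. $B_m$ denotes the braid group on $m$ strands with Artin generators $\sigma_1,\dots,\sigma_{m-1}$, where $\sigma_i$ is the elementary braid in which the $i$th and $(i+1)$st strands form a positive crossing (all strands oriented in the same direction along the braid). $\overline{x}$ denotes the closure of a braid $x$, an oriented link. For an integer $m\ge 2$ and $n\in\mathbb{Z}$, the torus link is $T(m,n)=\overline{(\sigma_1\sigma_2\cdots\sigma_{m-1})^n}$; thus $T(3,n)=\overline{(\sigma_1\sigma_2)^n}$ with $\sigma_1,\sigma_2\in B_3$. The HOMFLY polynomial $P(L;y,z)\in\mathbb{Z}[y^{\pm1},z^{\pm1}]$ of an oriented link $L$ is the unique oriented link invariant, computed from any diagram, with $P(\text{unknot};y,z)=1$ and $yP(D_+;y,z)+y^{-1}P(D_-;y,z)=zP(D_0;y,z)$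 for every skein triple $(D_+,D_-,D_0)$, i.e. three oriented diagrams identical except near one crossing, where the crossing is respectively positive, negative, and smoothed (orientation-consistently). *)

(* Defs.v *)
From HB Require Import structures.
From mathcomp Require Import all_boot all_order all_algebra.
From Stdlib Require Import Relations.

Set Implicit Arguments.
Unset Strict Implicit.
Unset Printing Implicit Defensive.

Import Order.TTheory GRing.Theory Num.Theory.
Local Open Scope ring_scope.

(******************************************************************************)
(* Oriented link diagrams in the plane, in generic position with respect to   *)
(* the height function.  Read from bottom to top, such a diagram is a word of *)
(* slices; each slice holds one elementary piece (a local minimum, a local    *)
(* maximum or a crossing), and all other strands cross it vertically.  The    *)
(* slice (i, e) has exactly i strands to the left of the piece e.             *)
(* An oriented horizontal section is a sequence of booleans, listing from     *)
(* left to right the strands met (true = oriented upwards).                   *)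
(******************************************************************************)

(* Cup a:   local minimum whose left leg has orientation a (hence right leg   *)
(*          ~~ a).                                                            *)
(* Cap:     local maximum, orientation determined by the strands below.       *)
(* Cross o: crossing; when o = true the arc joining bottom left to top right  *)
(*          is the overpassing one, otherwise it is the underpassing one.     *)
Inductive piece := Cup of bool | Cap | Cross of bool.

Definition slice := (nat * piece)%type.
Definition word := seq slice.

Definition dom (e : piece) : nat := if e is Cup _ then 0%N else 2%N.
Definition cod (e : piece) : nat := if e is Cap then 0%N else 2%N.

Definition act_piece (e : piece) (s : seq bool) : option (seq bool) :=
  match e, s with
  | Cup a, _ => Some [:: a, ~~ a & s]
  | Cap, [:: a, b & t] => if a != b then Some t else None
  | Cross _, [:: a, b & t] => Some [:: b, a & t]
  | _, _ => None
  end.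

Definition act_slice (x : slice) (s : seq bool) : option (seq bool) :=
  if (x.1 <= size s)%N
  then omap (cat (take x.1 s)) (act_piece x.2 (drop x.1 s))
  else None.

(* The section above w, given the section s below it; None if some slice of w *)
(* does not fit.                                                              *)
Fixpoint run (s : seq bool) (w : word) : option (seq bool) :=
  if w is x :: w' then obind (run^~ w') (act_slice x s) else Some s.

Record link_diagram := LinkDiagram {
  slices :> word;
  _ : run [::] slices == Some [::]
}.

(* Local moves.  Only the unoriented shape is prescribed: orientations are    *)
(* forced by the section below, and both sides of a move are required to be   *)
(* (parts of) oriented diagrams wherever moves are used.                      *)
Inductive local_move : word -> word -> Prop :=
(* planar isotopy *)
| Height_exchange i j e f : (i <= j)%N ->
    local_move [:: (i, e); (j + cod e, f)%N] [:: (j + dom e, f)%N; (i, e)]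
| Zigzag_left i a :
    local_move [:: (i, Cup a); (i.+1, Cap)] [::]
| Zigzag_right i a :
    local_move [:: (i.+1, Cup a); (i, Cap)] [::]
| Cap_slide i o :
    local_move [:: (i, Cross o); (i.+1, Cap)] [:: (i.+1, Cross (~~ o)); (i, Cap)]
| Cup_slide i a o :
    local_move [:: (i, Cup a); (i.+1, Cross o)]
               [:: (i.+1, Cup a); (i, Cross (~~ o))]
(* Reidemeister moves *)
| Reidemeister1_left i a o :
    local_move [:: (i, Cup a); (i.+1, Cross o); (i, Cap)] [::]
| Reidemeister1_right i a o :
    local_move [:: (i.+1, Cup a); (i, Cross o); (i.+1, Cap)] [::]
| Reidemeister2 i o :
    local_move [:: (i, Cross o); (i, Cross (~~ o))] [::]
(* The excluded case o1 = o3 <> o2 is the one in which the three strands pass *)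
(* cyclically over one another.                                               *)
| Reidemeister3 i o1 o2 o3 : ~~ ((o1 == o3) && (o1 != o2)) ->
    local_move [:: (i, Cross o1); (i.+1, Cross o2); (i, Cross o3)]
               [:: (i.+1, Cross o3); (i, Cross o2); (i.+1, Cross o1)].

Definition diagram_move (D D' : link_diagram) : Prop :=
  exists u v l r : word,
    [/\ local_move l r, D = u ++ l ++ v :> word & D' = u ++ r ++ v :> word].

(* Two diagrams represent the same oriented link. *)
Definition isotopic : link_diagram -> link_diagram -> Prop :=
  clos_refl_sym_trans link_diagram diagram_move.

Definition link_invariant (T : Type) (P : link_diagram -> T) : Prop :=
  forall D D' : link_diagram, isotopic D D' -> P D = P D'.

Lemma unknot_closed : run [::] [:: (0%N, Cup true); (0%N, Cap)] == Some [::].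
Proof. by []. Qed.

Definition unknot : link_diagram := LinkDiagram unknot_closed.

(* Tangent vectors at a crossing of the arc joining bottom left to top right, *)
(* resp. bottom right to top left; a tells whether the arc is oriented        *)
(* upwards.  The plane has its usual (counterclockwise) orientation.          *)
Definition tangent_rising (a : bool) : int * int :=
  if a then (1, 1) else (-1, -1).
Definition tangent_falling (b : bool) : int * int :=
  if b then (-1, 1) else (1, -1).

Definition det2 (u v : int * int) : int := u.1 * v.2 - u.2 * v.1.

(* Sign of the crossing Cross o whose bottom left (resp. bottom right) strand *)
(* has orientation a (resp. b).                                               *)
Definition positive_crossing (o a b : bool) : bool :=
  let over := if o then tangent_rising a else tangent_falling b in
  let under := if o then tangent_falling b else tangent_rising a in
  0 < det2 over under.

(* Oriented smoothing at position i of a crossing with bottom strands a, b:   *)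
(* two vertical strands if these are parallel, a local maximum below a local  *)
(* minimum otherwise.                                                         *)
Definition smoothing (i : nat) (a b : bool) : word :=
  if a == b then [::] else [:: (i, Cap); (i, Cup b)].

Definition skein_triple (Dp Dm D0 : link_diagram) : Prop :=
  exists (u v : word) (s : seq bool) (i : nat) (o : bool),
    let a := nth false s i in
    let b := nth false s i.+1 in
    [/\ run [::] u = Some s,
        positive_crossing o a b,
        Dp = u ++ (i, Cross o) :: v :> word,
        Dm = u ++ (i, Cross (~~ o)) :: v :> word
      & D0 = u ++ smoothing i a b ++ v :> word].

(******************************************************************************)
(* Braids and torus links                                                     *)
(******************************************************************************)

(* A word in the Artin generators of B_m: the letter (i, true) is             *)
(* sigma_(i+1), the letter (i, false) its inverse.                            *)
Definition braid_word (m : nat) := seq ('I_m.-1 * bool).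

Definition braid_inv m (x : braid_word m) : braid_word m :=
  rev [seq (g.1, ~~ g.2) | g : 'I_m.-1 * bool <- x].

Definition braid_expn m (x : braid_word m) (n : nat) : braid_word m :=
  flatten (nseq n x).

Definition braid_expz m (x : braid_word m) (n : int) : braid_word m :=
  match n with
  | Posz k => braid_expn x k
  | Negz k => braid_expn (braid_inv x) k.+1
  end.

(* Closure: the strands of the braid occupy the m leftmost positions and are  *)
(* oriented upwards; they are closed by m nested arcs running down the right. *)
Definition braid_slices m (x : braid_word m) : word :=
  [seq (g.1 : nat, Cross g.2) | g : 'I_m.-1 * bool <- x].

Definition closure_word m (x : braid_word m) : word :=
  [seq (i, Cup true) | i <- iota 0 m] ++ braid_slices x
    ++ [seq (i, Cap) | i <- rev (iota 0 m)].

Lemma run_cat s u v : run s (u ++ v) = obind (run^~ v) (run s u).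
Proof. by elim: u s => //= x u IHu s; case: (act_slice x s). Qed.

Lemma act_slice_cat i e (p t : seq bool) : size p = i ->
  act_slice (i, e) (p ++ t) = omap (cat p) (act_piece e t).
Proof.
move=> sp; rewrite /act_slice /= -sp size_cat leq_addr.
by rewrite take_size_cat ?drop_size_cat.
Qed.

Lemma nseqSr (T : Type) n (a : T) t : nseq n a ++ a :: t = a :: nseq n a ++ t.
Proof. by elim: n => //= n ->. Qed.

Lemma run_cups m :
  run [::] [seq (i, Cup true) | i <- iota 0 m]
    = Some (nseq m true ++ nseq m false).
Proof.
elim: m => // m IHm; rewrite -[in iota _ _]addn1 iotaD map_cat run_cat IHm /=.
by rewrite act_slice_cat ?size_nseq //= nseqSr.
Qed.

Lemma run_braid m (x : braid_word m) :
  run (nseq m true ++ nseq m false) (braid_slices x)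
    = Some (nseq m true ++ nseq m false).
Proof.
elim: x => //= -[i o] x IHx /=; set t := nseq m false in IHx *.
have Em : nseq m true = nseq i true ++ [:: true, true & nseq (m - i.+2) true].
  rewrite -[_ :: _]/(nseq (m - i.+2).+2 true) -nseqD; congr nseq.
  case: i => i /=; clear; case: m => [|m] //= ltim.
  by rewrite -!addSnnS subnKC.
have -> : act_slice (i : nat, Cross o) (nseq m true ++ t)
            = Some (nseq m true ++ t).
  by rewrite Em -catA act_slice_cat ?size_nseq.
exact: IHx.
Qed.

Lemma run_caps m :
  run (nseq m true ++ nseq m false) [seq (i, Cap) | i <- rev (iota 0 m)]
    = Some [::].
Proof.
elim: m => // m IHm; rewrite -[in iota _ _]addn1 iotaD rev_cat /= -nseqSr.
by rewrite act_slice_cat ?size_nseq //= IHm.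
Qed.

Lemma closure_closed m (x : braid_word m) :
  run [::] (closure_word x) == Some [::].
Proof. by rewrite run_cat run_cups /= run_cat run_braid /= run_caps. Qed.

Definition braid_closure m (x : braid_word m) : link_diagram :=
  LinkDiagram (closure_closed x).

(* sigma_1 sigma_2 ... sigma_(m-1) *)
Definition coxeter_braid (m : nat) : braid_word m :=
  [seq (i, true) | i <- enum 'I_m.-1].

Definition torus_link (m : nat) (n : int) : link_diagram :=
  braid_closure (braid_expz (coxeter_braid m) n).

(******************************************************************************)
(* The field Q(y, z), with Z[y^+-1, z^+-1] as a subring                       *)
(******************************************************************************)

Definition Qyz : fieldType := {fraction {poly {poly rat}}}.

Definition y : Qyz := tofrac ('X%:P : {poly {poly rat}}).
Definition z : Qyz := tofrac ('X : {poly {poly rat}}).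

Definition int_bipoly (p : {poly {poly int}}) : Qyz :=
  tofrac (map_poly (map_poly (intr : int -> rat)) p).

Definition laurent (f : Qyz) : Prop :=
  exists (p : {poly {poly int}}) (a b : nat), f = int_bipoly p / (y ^+ a * z ^+ b).

(* P is the HOMFLY polynomial, as a function of diagrams. *)
Definition is_homfly (P : link_diagram -> Qyz) : Prop :=
  [/\ forall D, laurent (P D),
      link_invariant P,
      P unknot = 1
    & forall Dp Dm D0, skein_triple Dp Dm D0 ->
        y * P Dp + y^-1 * P Dm = z * P D0].

(******************************************************************************)
(* Formal power series, given by their coefficients                           *)
(******************************************************************************)

Definition fps (K : fieldType) := nat -> K.

Definition fps_of_poly (K : fieldType) (p : {poly K}) : fps K := fun n => p`_n.

Definition fps_mul (K : fieldType) (f g : fps K) : fps K :=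
  fun n => \sum_(i < n.+1) f i * g (n - i)%N.

(* The first n coefficients of the inverse of f, when f 0 != 0. *)
Fixpoint fps_inv_coefs (K : fieldType) (f : fps K) (n : nat) : seq K :=
  if n is k.+1 then
    let s := fps_inv_coefs f k in
    rcons s ((f 0%N)^-1 * ((k == 0%N)%:R - \sum_(i < k) s`_i * f (k - i)%N))
  else [::].

Definition fps_inv (K : fieldType) (f : fps K) : fps K :=
  fun n => (fps_inv_coefs f n.+1)`_n.

Lemma size_fps_inv_coefs (K : fieldType) (f : fps K) n :
  size (fps_inv_coefs f n) = n.
Proof. by elim: n => //= n IHn; rewrite size_rcons IHn. Qed.

Lemma nth_fps_inv_coefs (K : fieldType) (f : fps K) n i : (i < n)%N ->
  (fps_inv_coefs f n)`_i = fps_inv f i.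
Proof.
elim: n => // n IHn; rewrite ltnS leq_eqVlt => /predU1P[-> // | ltin].
by rewrite /= nth_rcons size_fps_inv_coefs ltin IHn.
Qed.

Lemma fps_invM (K : fieldType) (f : fps K) : f 0%N != 0 ->
  fps_mul (fps_inv f) f =1 fps_of_poly 1.
Proof.
move=> f0 n; rewrite /fps_mul big_ord_recr /= subnn {2}/fps_inv /=.
rewrite nth_rcons size_fps_inv_coefs ltnn eqxx mulrAC mulVf // mul1r.
rewrite (eq_bigr (fun i : 'I_n => (fps_inv_coefs f n)`_i * f (n - i)%N)).
  by rewrite addrC subrK /fps_of_poly coef1.
by move=> i _; rewrite nth_fps_inv_coefs.
Qed.

Definition fps_div (K : fieldType) (f g : fps K) : fps K :=
  fps_mul f (fps_inv g).

Definition G_denominator : {poly Qyz} :=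
  1 - (y ^- 2 * z ^+ 2 - y ^- 2) *: 'X + (y ^- 4 * z ^+ 2) *: 'X^2
    - (y ^- 6 * z ^+ 2 - y ^- 6) *: 'X^3 + y ^- 8 *: 'X^4.

Definition G : fps Qyz := fps_div (fps_of_poly 'X^3) (fps_of_poly G_denominator).

(* Main.v *)
Require Import Defs.
From HB Require Import structures.
From mathcomp Require Import all_boot all_order all_algebra.
From mathcomp Require Import ring zify.
From Stdlib Require Import Relations.
Import Order.TTheory GRing.Theory Num.Theory.
Local Open Scope ring_scope.

(** The skein relation together with the second Reidemeister move makes any
    HOMFLY polynomial, viewed as a function of closed positive 3-braids, factor
    through the Hecke algebra of B_3: with q = z / y and t = y^-2 the two
    generators satisfy s^2 = q s - t, besides the braid relation coming from
    the third Reidemeister move.  In that algebra X = s_1 s_2 is annihilated by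
    a polynomial of degree 4, namely the product of (X - a^2)(X - b^2), where
    a, b are the roots of s^2 - q s + t (the two one-dimensional
    representations), and of X^2 - t X + t^2 (the Burau representation).  Its
    reciprocal polynomial is the denominator of the generating series of G.
    Hence n |-> P(T(3, n)) and G satisfy the same linear recurrence of order 4
    ([hecke_coxeter_recurrence], [fps_div_quartic_recurrence]), and it remains
    to compare initial values ([torus3_closed_formula]).

    The values of P on the closures of 1, X, X^2 and X^3 are obtained by
    removing the last strand.  When s_2 occurs once, at any place, in a word,
    the innermost arc of the closure can be shrunk towards that crossing and
    removed by a first Reidemeister move ([value_markov]).  When s_2 does not
    occur, the innermost arc is a split circle; applying the skein relation to
    the two kinks on it gives a factor (y + y^-1) / z ([value_split]).  So
    everything reduces to the closures of s_1^k in B_2, and these to unknots.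
    Since destabilization works in the middle of a word, invariance of P under
    conjugation of braids never enters. *)

(** * The Hecke algebra of three strands *)

(** A linear form on the Hecke algebra, given by its values on positive words;
    false and true stand for the two generators. *)
Definition hecke_functional {K : comNzRingType} (q t : K) (g : seq bool -> K) :=
  (forall u s v,
     g (u ++ [:: s, s & v]) = q * g (u ++ s :: v) - t * g (u ++ v)) /\
  (forall u v, g (u ++ [:: true, false, true & v])
                 = g (u ++ [:: false, true, false & v])).

(** With D = s_1 s_2 s_1 and X = s_1 s_2, one has X^3 = D^2, and X^3 - q X D is
    a combination of D, s_1 and 1.  Multiplying this identity by X expresses X^4
    through X^2 D, X D, D and X; moreover X^2 D is a combination of X^3, X^2, X
    and s_1.  The terms in X D, D and s_1 so obtained are exactly - t times those
    of the identity for X^3, which therefore eliminates them. *)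
Lemma hecke_coxeter_recurrence (K : comNzRingType) (q t : K) (g : seq bool -> K) :
  hecke_functional q t g ->
  let A n := g (flatten (nseq n [:: false; true])) in
  forall n, A n.+4 = (q ^+ 2 - t) * A n.+3 - t * q ^+ 2 * A n.+2
                     + (t ^+ 2 * q ^+ 2 - t ^+ 3) * A n.+1 - t ^+ 4 * A n.
Proof.
case=> quad braid A n; rewrite /A /=.
set v := flatten (nseq n _).
pose a := false; pose b := true; rewrite -/a -/b.
(* X^3 = q X D - t q D + t^2 q s_1 - t^3 *)
have X3 u : g (u ++ [:: a, b, a, b, a, b & v])
  = q * g (u ++ [:: a, b, a, b, a & v]) - t * q * g (u ++ [:: a, b, a & v])
    + t ^+ 2 * q * g (u ++ [:: a & v]) - t ^+ 3 * g (u ++ v).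
  have E1 := braid (u ++ [:: a; b; a]) v.
  have E2 := quad (u ++ [:: a; b]) a [:: b, a & v].
  have E3 := quad (u ++ [:: a]) b [:: a & v].
  have E4 := quad u a v.
  move: E1 E2 E3 E4; rewrite -!catA /= => -> -> -> ->; ring.
(* X^2 D = q X^3 - t D X *)
have X2D : g [:: a, b, a, b, a, b, a & v]
  = q * g [:: a, b, a, b, a, b & v] - t * g [:: a, b, a, a, b & v].
  by rewrite -(braid [:: a; b; a; b] v) (quad [:: a; b; a] b [:: a, b & v]).
(* D X = q X^2 - t q X + t^2 s_1 *)
have DX : g [:: a, b, a, a, b & v]
  = q * g [:: a, b, a, b & v] - t * q * g [:: a, b & v] + t ^+ 2 * g (a :: v).
  rewrite (quad [:: a; b] a [:: b & v]) (quad [:: a] b v) /=; ring.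
have := X3 [::]; rewrite (X3 [:: a; b]) /= X2D DX => ->; ring.
Qed.

(** * Linear recurrences and the series G *)

(** The coefficients of index at least d in the identity (X^d / f) f = X^d. *)
Lemma fps_div_polyXn_mul (K : fieldType) d (f : fps K) n : f 0%N != 0 ->
  \sum_(j < (d + n).+1) fps_div (fps_of_poly 'X^d) f j * f (d + n - j)%N
    = (n == 0%N)%:R.
Proof.
move=> f0.
have shift j : fps_div (fps_of_poly 'X^d) f j
    = if (j < d)%N then 0 else fps_inv f (j - d)%N.
  rewrite /fps_div /fps_mul; case: ltnP => dj.
    rewrite big1 // => i _; rewrite /fps_of_poly coefXn.
    by rewrite ltn_eqF ?mul0r // (leq_trans _ dj).
  have dj1 : (d < j.+1)%N by [].
  rewrite (bigD1 (Ordinal dj1)) //= /fps_of_poly coefXn eqxx mul1r.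
  rewrite big1 ?addr0 // => i; rewrite coefXn -val_eqE /= => /negPf ->.
  by rewrite mul0r.
rewrite -addnS big_split_ord /= big1 ?add0r => [|i _]; last first.
  by rewrite shift ltn_ord mul0r.
have := @fps_invM _ f f0 n; rewrite /fps_mul /fps_of_poly coef1 => <-.
apply: eq_bigr => i _; rewrite shift /= ltnNge leq_addr /= addKn.
by rewrite subnDl.
Qed.

Lemma fps_div_quartic_recurrence (K : fieldType) (c1 c2 c3 c4 : K) n :
  let D : {poly K} := 1 - c1 *: 'X + c2 *: 'X^2 - c3 *: 'X^3 + c4 *: 'X^4 in
  let g := fps_div (fps_of_poly 'X^3) (fps_of_poly D) in
  [/\ g 0%N = 0, g 1%N = 0, g 2%N = 0, g 3%N = 1 &
      g n.+4 = c1 * g n.+3 - c2 * g n.+2 + c3 * g n.+1 - c4 * g n].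
Proof.
move=> D g.
have D0 : D`_0 = 1.
  by rewrite !(coefD, coefN, coefZ, coef1, coefX, coefXn) /=; ring.
have D1 : D`_1 = - c1.
  by rewrite !(coefD, coefN, coefZ, coef1, coefX, coefXn) /=; ring.
have D2 : D`_2 = c2.
  by rewrite !(coefD, coefN, coefZ, coef1, coefX, coefXn) /=; ring.
have D3 : D`_3 = - c3.
  by rewrite !(coefD, coefN, coefZ, coef1, coefX, coefXn) /=; ring.
have D4 : D`_4 = c4.
  by rewrite !(coefD, coefN, coefZ, coef1, coefX, coefXn) /=; ring.
have D5 i : D`_(5 + i) = 0.
  by rewrite !(coefD, coefN, coefZ, coef1, coefX, coefXn) /=; ring.
have f0 : fps_of_poly D 0%N != 0 by rewrite /fps_of_poly D0 oner_eq0.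
have g0 k : (k < 3)%N -> g k = 0.
  move=> k3; rewrite /g /fps_div /fps_mul big1 // => i _.
  by rewrite /fps_of_poly coefXn ltn_eqF ?mul0r // (leq_trans _ k3).
split; try exact: g0.
  have := fps_div_polyXn_mul K 3 _ 0 f0.
  rewrite -/g addn0 !big_ord_recr big_ord0 /= (g0 0%N) // (g0 1%N) // (g0 2%N) //.
  rewrite /fps_of_poly subnn D0.
  by rewrite !mul0r !add0r mulr1.
(* In the coefficient of X^(n+4) of g D only the last five terms survive. *)
have := fps_div_polyXn_mul K 3 _ n.+1 f0; rewrite -/g addnS add3n !big_ord_recr.
rewrite /= big1 ?add0r => [|i _]; last first.
  have -> : (n.+4 - i = 5 + (n.-1 - i))%N by have := ltn_ord i; lia.
  by rewrite /fps_of_poly D5 mulr0.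
have sub k : (k + n - n = k)%N := addnK n k.
rewrite !subSS (sub 4%N) (sub 3%N) (sub 2%N) (sub 1%N) (sub 0%N) /fps_of_poly.
rewrite D0 D1 D2 D3 D4 mulr1 addrC => /eqP; rewrite addr_eq0 => /eqP ->; ring.
Qed.

Lemma eq_recurrence4 (T : Type) (F : T -> T -> T -> T -> T) (u v : nat -> T) :
    (forall n, u n.+4 = F (u n) (u n.+1) (u n.+2) (u n.+3)) ->
    (forall n, v n.+4 = F (v n) (v n.+1) (v n.+2) (v n.+3)) ->
    u 0%N = v 0%N -> u 1%N = v 1%N -> u 2%N = v 2%N -> u 3%N = v 3%N ->
  u =1 v.
Proof.
move=> recu recv e0 e1 e2 e3 n.
suff [] : [/\ u n = v n, u n.+1 = v n.+1, u n.+2 = v n.+2 & u n.+3 = v n.+3] by [].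
elim: n => [|n [en en1 en2 en3]]; first by [].
by split=> //; rewrite recu recv en en1 en2 en3.
Qed.

(** The four values of A are those of the closures of X^0, ..., X^3, where d is
    the value of the two-component unlink, and e2 and e3 are those of the
    closures of s_1^2 and s_1^3 in B_2.  A 0 serves only to reach A 4 by
    the recurrence, since the formula itself begins at index 1. *)
Lemma torus3_closed_formula (K : fieldType) (y z : K) (A G : nat -> K) :
  let q := z / y in let t := y ^- 2 in let d := (y + y^-1) / z in
  let e2 := q - t * d in let e3 := q * e2 - t in
  y != 0 -> z != 0 ->
  A 0%N = d * d -> A 1%N = 1 -> A 2%N = e3 ->
  A 3%N = q * (q * e3 - t * e2) - t * (q * e2 - t * (d * e2)) ->
  (forall n, A n.+4 = (q ^+ 2 - t) * A n.+3 - t * q ^+ 2 * A n.+2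
                      + (t ^+ 2 * q ^+ 2 - t ^+ 3) * A n.+1 - t ^+ 4 * A n) ->
  G 0%N = 0 -> G 1%N = 0 -> G 2%N = 0 -> G 3%N = 1 ->
  (forall n, G n.+4 =
     (y ^- 2 * z ^+ 2 - y ^- 2) * G n.+3 - (y ^- 4 * z ^+ 2) * G n.+2
     + (y ^- 6 * z ^+ 2 - y ^- 6) * G n.+1 - y ^- 8 * G n) ->
  forall n,
  A n.+1 =
    (y ^+ 2 + 1) * z ^- 2 * G n.+4
    + ((1 + y ^- 2) * z ^- 2 - y ^- 2) * G n.+3
    + (y ^- 6 - (y ^- 6 + y ^- 8) * z ^- 2) * G n.+1
    - (y ^- 8 + y ^- 10) * z ^- 2 * G n.
Proof.
move=> q t d e2 e3 y0 z0 A0 A1 A2 A3 recA G0 G1 G2 G3 recG.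
have G4 := recG 0%N; have G5 := recG 1%N; have G6 := recG 2%N.
have G7 := recG 3%N; have A4 := recA 0%N.
pose F a0 a1 a2 a3 : K :=
  (y ^- 2 * z ^+ 2 - y ^- 2) * a3 - (y ^- 4 * z ^+ 2) * a2
     + (y ^- 6 * z ^+ 2 - y ^- 6) * a1 - y ^- 8 * a0.
apply: (eq_recurrence4 K F (fun n => A n.+1)) => [n|n||||].
- by rewrite (recA n.+1) /F /q /t /=; field.
- by rewrite (recG n.+4) (recG n.+3) (recG n.+1) (recG n) /F /=; ring.
- by rewrite A1 G4 G3 G2 G1 G0; field; rewrite y0 z0.
- by rewrite A2 G5 G4 G3 G2 G1 G0 /e3 /e2 /q /t /d; field; rewrite y0 z0.
- by rewrite A3 G6 G5 G4 G3 G2 G1 G0 /e3 /e2 /q /t /d; field; rewrite y0 z0.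
rewrite A4 A3 A2 A1 A0 G7 G6 G5 G4 G3 G2 G1 G0 /e3 /e2 /q /t /d.
by field; rewrite y0 z0.
Qed.

(** * Values of a HOMFLY polynomial on words of slices *)

Lemma y_neq0 : y != 0.
Proof. by rewrite tofrac_eq0 polyC_eq0 polyX_eq0. Qed.

Lemma z_neq0 : z != 0.
Proof. by rewrite tofrac_eq0 polyX_eq0. Qed.

HB.instance Definition _ := [isSub for slices].

(** Extending P by 0 to words that are not closed diagrams lets diagrams be
    cut and pasted without carrying proofs of closedness. *)
Definition value (P : link_diagram -> Qyz) (w : word) : Qyz :=
  oapp P 0 (insub w).

Lemma value_slices P (D : link_diagram) : value P D = P D.
Proof. by rewrite /value valK. Qed.

Lemma value_move P u l r v s s' : is_homfly P -> local_move l r ->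
    run [::] u = Some s -> run s l = Some s' -> run s r = Some s' ->
    run s' v = Some [::] ->
  value P (u ++ l ++ v) = value P (u ++ r ++ v).
Proof.
case=> _ invP _ _ lr us sl sr sv.
have Dl : run [::] (u ++ l ++ v) == Some [::].
  by rewrite run_cat us /= run_cat sl /= sv.
have Dr : run [::] (u ++ r ++ v) == Some [::].
  by rewrite run_cat us /= run_cat sr /= sv.
rewrite (value_slices P (LinkDiagram Dl)) (value_slices P (LinkDiagram Dr)).
by apply: invP; apply: rst_step; exists u, v, l, r.
Qed.

Lemma run_cross_up i m o t : (i.+1 < m)%N ->
  act_slice (i, Cross o) (nseq m true ++ t) = Some (nseq m true ++ t).
Proof.
move=> ltim.
have -> : nseq m true = nseq i true ++ [:: true, true & nseq (m - i.+2) true].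
  by rewrite -[_ :: _]/(nseq (m - i.+2).+2 true) -nseqD -!addSnnS subnKC.
by rewrite -catA act_slice_cat ?size_nseq.
Qed.

Lemma value_skein P u i v m t : is_homfly P -> (i.+1 < m)%N ->
    run [::] u = Some (nseq m true ++ t) ->
    run (nseq m true ++ t) v = Some [::] ->
  y * value P (u ++ (i, Cross true) :: v)
  + y^-1 * value P (u ++ (i, Cross false) :: v) = z * value P (u ++ v).
Proof.
case=> _ _ _ skP im us sv.
have Dc o : run [::] (u ++ (i, Cross o) :: v) == Some [::].
  by rewrite run_cat us /= run_cross_up //= sv.
have D0 : run [::] (u ++ v) == Some [::] by rewrite run_cat us /= sv.
rewrite (value_slices P (LinkDiagram (Dc true))).
rewrite (value_slices P (LinkDiagram (Dc false))).
rewrite (value_slices P (LinkDiagram D0)).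
apply: skP; exists u, v, (nseq m true ++ t), i, true => /=.
by rewrite !nth_cat size_nseq im (ltnW im) !nth_nseq im (ltnW im).
Qed.

(** * Closures of positive braids *)

(** Letter i of a positive word is the generator crossing the strands at
    positions i and i + 1, counted from 0. *)
Definition in_braid m (w : seq nat) := all (fun i => i.+1 < m)%N w.

Definition positive_slices (w : seq nat) : word := [seq (i, Cross true) | i <- w].

Definition cups m : word := [seq (i, Cup true) | i <- iota 0 m].
Definition caps m : word := [seq (i, Cap) | i <- rev (iota 0 m)].
Definition closed_word m (w : seq nat) := cups m ++ positive_slices w ++ caps m.

Lemma positive_slices_cat w1 w2 :
  positive_slices (w1 ++ w2) = positive_slices w1 ++ positive_slices w2.
Proof. exact: map_cat. Qed.

Lemma cupsS m : cups m.+1 = cups m ++ [:: (m, Cup true)].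
Proof. by rewrite /cups -addn1 iotaD map_cat. Qed.

Lemma capsS m : caps m.+1 = (m, Cap) :: caps m.
Proof. by rewrite /caps -addn1 iotaD rev_cat. Qed.

Lemma in_braidS m w : in_braid m w -> in_braid m.+1 w.
Proof. by apply: sub_all => i /leqW. Qed.

Lemma run_positive m w t : in_braid m w ->
  run (nseq m true ++ t) (positive_slices w) = Some (nseq m true ++ t).
Proof.
by elim: w => //= i w IHw /andP[im mw]; rewrite run_cross_up //= IHw.
Qed.

Lemma run_cups_positive m w : in_braid m w ->
  run [::] (cups m ++ positive_slices w) = Some (nseq m true ++ nseq m false).
Proof. by move=> mw; rewrite run_cat run_cups /= run_positive. Qed.

Lemma run_positive_caps m w : in_braid m w ->
  run (nseq m true ++ nseq m false) (positive_slices w ++ caps m) = Some [::].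
Proof. by move=> mw; rewrite run_cat run_positive //= run_caps. Qed.

(** Stated over an abstract field, so that normalizing the rational expressions
    does not unfold the construction of Q(y, z). *)
Lemma skein_solve (K : fieldType) (y z a b c : K) : y != 0 ->
  y * a + y^-1 * b = z * c -> a = z / y * c - y ^- 2 * b.
Proof.
move=> y0 E; apply: (mulfI y0); rewrite (canRL (addrK _) E); field; exact: y0.
Qed.

Lemma skein_solve_smoothing (K : fieldType) (y z a c : K) : z != 0 ->
  y * a + y^-1 * a = z * c -> c = (y + y^-1) / z * a.
Proof. by move=> z0; rewrite -mulrDl mulrAC => ->; rewrite mulrC mulKf. Qed.

(** The skein relation at the second of two equal letters: turning that crossing
    over makes the pair cancel by a second Reidemeister move, and smoothing it
    leaves a single letter. *)
Lemma value_hecke P m w1 i w2 : is_homfly P ->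
    in_braid m w1 -> (i.+1 < m)%N -> in_braid m w2 ->
  value P (closed_word m (w1 ++ [:: i, i & w2])) =
    z / y * value P (closed_word m (w1 ++ i :: w2))
    - y ^- 2 * value P (closed_word m (w1 ++ w2)).
Proof.
move=> hP mw1 im mw2.
have R2 : value P (closed_word m (w1 ++ w2)) =
    value P (((cups m ++ positive_slices w1) ++ [:: (i, Cross true)])
               ++ (i, Cross false) :: positive_slices w2 ++ caps m).
  rewrite /closed_word positive_slices_cat -!catA !(catA (cups m)); symmetry.
  apply: (value_move P _ [:: (i, Cross true); (i, Cross false)] [::]
            (positive_slices w2 ++ caps m) (nseq m true ++ nseq m false)
            (nseq m true ++ nseq m false) hP) => //.
  - exact: (Reidemeister2 i true).
  - exact: run_cups_positive.
  - by do 2 rewrite /= run_cross_up //.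
  - exact: run_positive_caps.
have := value_skein P
  ((cups m ++ positive_slices w1) ++ [:: (i, Cross true)]) i
  (positive_slices w2 ++ caps m) m (nseq m false) hP im.
rewrite -R2 run_cat run_cups_positive //= run_cross_up // => /(_ erefl).
move=> /(_ (run_positive_caps _ _ mw2)).
rewrite /closed_word !positive_slices_cat -!catA /= => E.
exact: skein_solve y_neq0 E.
Qed.

Lemma value_braid P m w1 i w2 : is_homfly P ->
    in_braid m w1 -> (i.+2 < m)%N -> in_braid m w2 ->
  value P (closed_word m (w1 ++ [:: i, i.+1, i & w2])) =
    value P (closed_word m (w1 ++ [:: i.+1, i, i.+1 & w2])).
Proof.
move=> hP mw1 im mw2.
have im' := ltnW im.
rewrite /closed_word !positive_slices_cat -!catA !(catA (cups m)).
apply: (value_move P _ (positive_slices [:: i; i.+1; i])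
          (positive_slices [:: i.+1; i; i.+1]) (positive_slices w2 ++ caps m)
          (nseq m true ++ nseq m false) (nseq m true ++ nseq m false) hP).
- exact: Reidemeister3.
- exact: run_cups_positive.
- by apply: run_positive; rewrite /= im im'.
- by apply: run_positive; rewrite /= im im'.
- exact: run_positive_caps.
Qed.

(** A minimum or maximum to the right of m upward strands moves freely past
    crossings of these strands. *)
Lemma value_slide P m f w u v t t' : is_homfly P ->
    f = Cup true \/ f = Cap -> in_braid m w ->
    run [::] u = Some (nseq m true ++ t) ->
    act_slice (m, f) (nseq m true ++ t) = Some (nseq m true ++ t') ->
    run (nseq m true ++ t') v = Some [::] ->
  value P (u ++ (m, f) :: positive_slices w ++ v) =
  value P (u ++ positive_slices w ++ (m, f) :: v).
Proof.
move=> hP fE mw us sf sv; elim: w u us mw => //= i w IHw u us /andP[im mw].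
rewrite -[_ ++ (i, _) :: positive_slices w ++ _ :: v]cat_rcons -IHw //; last first.
  by rewrite -cats1 run_cat us /= run_cross_up.
rewrite cat_rcons.
have lm : local_move [:: (i, Cross true); (m, f)] [:: (m, f); (i, Cross true)].
  have := @Height_exchange i (m - 2) (Cross true) f.
  rewrite /= subnK ?(leq_trans _ im) //; apply.
  by rewrite leq_subRL ?(leq_trans _ im).
symmetry.
apply: (value_move P u _ _ (positive_slices w ++ v) (nseq m true ++ t)
          (nseq m true ++ t') hP lm us).
- by rewrite /= run_cross_up //= sf.
- by rewrite /= sf /= run_cross_up.
- by rewrite run_cat run_positive.
Qed.

(** The last strand of a closed braid is joined by the innermost arc of the
    closure.  If it takes part in a single crossing, its minimum slides up and
    its maximum slides down until they meet that crossing, and the kink thus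
    formed is removed by a first Reidemeister move. *)
Lemma value_destabilize P m o w1 w2 : is_homfly P ->
    in_braid m.+1 w1 -> in_braid m.+1 w2 ->
  value P (cups m.+2 ++ positive_slices w1 ++
             (m, Cross o) :: positive_slices w2 ++ caps m.+2) =
  value P (closed_word m.+1 (w1 ++ w2)).
Proof.
move=> hP mw1 mw2.
set up := nseq m.+1 true; set dn := nseq m.+1 false.
have pos_up t : run (up ++ t) (positive_slices w2) = Some (up ++ t).
  exact: run_positive.
have cup_up : act_slice (m.+1, Cup true) (up ++ dn)
                = Some (up ++ [:: true, false & dn]).
  by rewrite act_slice_cat ?size_nseq.
have cap_up : act_slice (m.+1, Cap) (up ++ [:: true, false & dn])
                = Some (up ++ dn).
  by rewrite act_slice_cat ?size_nseq.
have cross_up : act_slice (m, Cross o) (up ++ [:: true, false & dn])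
                  = Some (up ++ [:: true, false & dn]).
  by rewrite nseqSr -[true :: _ ++ _]/(nseq m.+2 true ++ _) run_cross_up.
have run1 := run_cups_positive _ _ mw1.
have run2 := run_positive_caps _ _ mw2.
rewrite cupsS capsS -!catA [[:: _] ++ _]cat1s.
rewrite (value_slide P m.+1 (Cup true) w1 (cups m.+1) _ dn
           [:: true, false & dn] hP) //; first last.
- rewrite /= cross_up /= run_cat pos_up /= cap_up /=.
  exact: run_caps.
- exact: run_cups.
- by left.
rewrite -[(m.+1, Cup true) :: _]/([:: (m.+1, Cup true); (m, Cross o)] ++ _).
rewrite 2!catA -(value_slide P m.+1 Cap w2 _ (caps m.+1)
                   [:: true, false & dn] dn hP) //; first last.
- exact: run_caps.
- by rewrite run_cat run1 /= cup_up /= cross_up.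
- by right.
rewrite /closed_word positive_slices_cat -!catA !(catA (cups m.+1)).
apply: (value_move P _ [:: (m.+1, Cup true); (m, Cross o); (m.+1, Cap)] [::]
          (positive_slices w2 ++ caps m.+1) (up ++ dn) (up ++ dn) hP) => //.
- exact: Reidemeister1_right.
- by rewrite /= cup_up /= cross_up /= cap_up.
Qed.

Lemma value_markov P m w1 w2 : is_homfly P ->
    in_braid m.+1 w1 -> in_braid m.+1 w2 ->
  value P (closed_word m.+2 (w1 ++ m :: w2)) =
  value P (closed_word m.+1 (w1 ++ w2)).
Proof.
move=> hP mw1 mw2; rewrite -(value_destabilize P m true) //.
by rewrite /closed_word positive_slices_cat -!catA.
Qed.

(** Adding a crossing of either sign between the last two strands gives the same
    link by destabilization, and the diagram with the split circle is the
    smoothing of both. *)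
Lemma value_split P m w : is_homfly P -> in_braid m.+1 w ->
  value P (closed_word m.+2 w) = (y + y^-1) / z * value P (closed_word m.+1 w).
Proof.
move=> hP mw; have mw' := in_braidS _ _ mw.
have := value_skein P (cups m.+2 ++ positive_slices w) m (caps m.+2) m.+2
  (nseq m.+2 false) hP (leqnn _) (run_cups_positive _ _ mw') (run_caps _).
have D o := value_destabilize P m o w [::] hP mw isT.
move: (D true) (D false); rewrite /= !cats0 -!catA => -> -> E.
exact: skein_solve_smoothing z_neq0 E.
Qed.

Lemma value_unknot P : is_homfly P -> value P (closed_word 1 [::]) = 1.
Proof. by case=> _ _ <- _; rewrite -value_slices. Qed.

(** * Closed 3-braids *)

Definition closed_word3 (w : seq bool) := closed_word 3 (map nat_of_bool w).

Lemma in_braid3 w : in_braid 3 (map nat_of_bool w).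
Proof. by rewrite /in_braid all_map; apply/allP => -[]. Qed.

Lemma value_hecke_functional P : is_homfly P ->
  hecke_functional (z / y) (y ^- 2) (value P \o closed_word3).
Proof.
move=> hP; split=> [u s v|u v]; rewrite /= /closed_word3 !map_cat /=.
  by rewrite value_hecke ?in_braid3 //; case: s.
by rewrite -value_braid ?in_braid3.
Qed.

Lemma value_torus3 P (n : nat) :
  P (torus_link 3 n) = value P (closed_word3 (flatten (nseq n [:: false; true]))).
Proof.
rewrite -value_slices; congr (value P _).
rewrite /= /closure_word /closed_word3 /closed_word; congr (_ ++ (_ ++ _)).
rewrite /braid_slices /braid_expz /braid_expn /positive_slices.
elim: n => //= n IHn; rewrite map_cat {}IHn.
rewrite -[RHS]/([:: (0, Cross true); (1, Cross true)]%N ++ _); congr (_ ++ _).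
rewrite /coxeter_braid -map_comp.
by rewrite (map_comp (fun k => (k, Cross true)) val) val_enum_ord.
Qed.

(** The values on the closures of s_1^2 and s_1^3 in B_2: the Hopf link and the
    trefoil. *)
Lemma value_powers2 P : is_homfly P ->
  let q := z / y in let t := y ^- 2 in let d := (y + y^-1) / z in
  let e2 := q - t * d in let e3 := q * e2 - t in
  [/\ value P (closed_word 2 [::]) = d, value P (closed_word 2 [:: 0%N]) = 1,
      value P (closed_word 2 [:: 0; 0]%N) = e2,
      value P (closed_word 2 [:: 0; 0; 0]%N) = e3
    & value P (closed_word 2 [:: 0; 0; 0; 0]%N) = q * e3 - t * e2].
Proof.
move=> hP q t d e2 e3.
have v0 : value P (closed_word 2 [::]) = d.
  by rewrite value_split // value_unknot // mulr1.
have v1 : value P (closed_word 2 [:: 0%N]) = 1.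
  by rewrite (value_markov P 0 [::] [::] hP) // value_unknot.
have v2 : value P (closed_word 2 [:: 0; 0]%N) = e2.
  by rewrite (value_hecke P 2 [::] 0 [::] hP) //= v0 v1 mulr1.
have v3 : value P (closed_word 2 [:: 0; 0; 0]%N) = e3.
  by rewrite (value_hecke P 2 [::] 0 [:: 0%N] hP) //= v2 v1 mulr1.
by split=> //; rewrite (value_hecke P 2 [::] 0 [:: 0; 0]%N hP) //= v2 v3.
Qed.

Theorem theorem27 (P : link_diagram -> Qyz) (hP : is_homfly P)
    (n : nat) (hn : (1 <= n)%N) :
  P (torus_link 3 n%:Z) =
    (y ^+ 2 + 1) * z ^- 2 * G (n + 3)%N
    + ((1 + y ^- 2) * z ^- 2 - y ^- 2) * G (n + 2)%N
    + (y ^- 6 - (y ^- 6 + y ^- 8) * z ^- 2) * G n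
    - (y ^- 8 + y ^- 10) * z ^- 2 * G (n - 1)%N.
Proof.
case: n hn => // n _; rewrite addn3 addn2 subn1 value_torus3.
have [v0 v1 v2 v3 v4] := value_powers2 P hP.
have recG k := fps_div_quartic_recurrence Qyz (y ^- 2 * z ^+ 2 - y ^- 2)
  (y ^- 4 * z ^+ 2) (y ^- 6 * z ^+ 2 - y ^- 6) (y ^- 8) k.
have [G0 G1 G2 G3 _] := recG 0%N.
pose A k := value P (closed_word3 (flatten (nseq k [:: false; true]))).
apply: (torus3_closed_formula Qyz y z A G y_neq0 z_neq0) => //.
- by rewrite /A /closed_word3 /= value_split // v0.
- by rewrite /A /closed_word3 /= (value_markov P 1 [:: 0%N] [::]).
- (* s_1 s_2 s_1 s_2 = s_1^2 s_2 s_1 *)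
  rewrite /A /closed_word3 /= -(value_braid P 3 [:: 0%N] 0 [::] hP) //=.
  by rewrite (value_markov P 1 [:: 0; 0]%N [:: 0%N]).
- (* (s_1 s_2)^3 = s_1 s_2 s_1^2 s_2 s_1, and the square is then expanded *)
  rewrite /A /closed_word3 /= -(value_braid P 3 [:: 0; 1; 0]%N 0 [::] hP) //=.
  rewrite (value_hecke P 3 [:: 0; 1]%N 0 [:: 1; 0]%N hP) //=.
  rewrite -(value_braid P 3 [:: 0%N] 0 [:: 0%N] hP) //=.
  rewrite (value_markov P 1 [:: 0; 0]%N [:: 0; 0]%N hP) //= v4.
  rewrite (value_hecke P 3 [:: 0%N] 1 [:: 0%N] hP) //=.
  rewrite (value_markov P 1 [:: 0%N] [:: 0%N] hP) //=.
  by rewrite (value_split P 1 [:: 0; 0]%N hP) //= v2.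
- exact: hecke_coxeter_recurrence (value_hecke_functional P hP).
- by move=> k; case: (recG k).
Qed.
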